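(* Let $\widetilde X=(X,X^-)$ be an oriented $N$-dimensional rectangle of a metric space $Z$, let $\psi: Z\supseteq D_\psi\to Z$ be a map and let $\mathcal D\subseteq X\cap D_\psi$. Suppose that $(\mathcal D,\mathcal K,\psi)$ stretches $\widetilde X$ to $\widetilde X$ along the paths, for some compact set $\mathcal K\subseteq\mathcal D$. Then there exists $\widetilde w\in\mathcal K$ such that $\psi(\widetilde w)=\widetilde w$.
   Context: $I^N=[0,1]^N$. An oriented $N$-dimensional rectangle of a metric space $Z$ is a pair $\widetilde X=(X,X^-)$ where $X=h(I^N)\subseteq Z$ for some homeomorphism $h$ of $I^N$ onto its image $X$, and $X^-=X_\ell\cup X_r$ with $X_\ell=h(\{x\in I^N:x_N=0\})$ and $X_r=h(\{x\in I^N:x_N=1\})$. A path is a continuous map $\gamma$ from a compact interval; $\overline\gamma$ denotes its range; a sub-path of $\gamma$ is the restriction of $\gamma$ to a closed subinterval of its domain. Stretching along the paths: let $\widetilde X=(X,X^-)$, $\widetilde Y=(Y,Y^-)$ be oriented $N$-dimensional rectangles of $Z$, $\psi:Z\supseteq D_\psi\to Z$ a map (not necessarily continuous on its whole domain), $\mathcal D\subseteq X\cap D_\psi$ and $\mathcal K\subseteq\mathcal D$ a compact set. We say that $(\mathcal D,\mathcal K,\psi)$ stretches $\widetilde X$ to $\widetilde Y$ along the paths if $\psi$ is continuous on $\mathcal K$ and for every path $\gamma$ with $\overline\gamma\subseteq X$, $\overline\gamma\cap X_\ell\neq\emptyset$ and $\overline\gamma\cap X_r\neq\emptyset$, there is a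 sub-path $\sigma$ of $\gamma$ such that $\overline\sigma\subseteq\mathcal K$, $\psi(\overline\sigma)\subseteq Y$, $\psi(\overline\sigma)\cap Y_\ell\neq\emptyset$ and $\psi(\overline\sigma)\cap Y_r\neq\emptyset$. *)

(* Defs.v *)
From HB Require Import structures.
From mathcomp Require Import all_boot all_order all_algebra.
From mathcomp Require Import all_classical all_reals all_analysis.

Set Implicit Arguments.
Unset Strict Implicit.
Unset Printing Implicit Defensive.

Import Order.TTheory GRing.Theory Num.Theory.
Import numFieldNormedType.Exports.

Local Open Scope classical_set_scope.
Local Open Scope ring_scope.

Definition unit_cube (R : realType) (N : nat) : set 'rV[R]_N :=
  [set x | forall i, 0 <= x ord0 i <= 1].

(* The map h is only relevant on A: its values outside A are arbitrary, and
   continuity is that of the restriction to A, for the relative topology. The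
   inverse g is likewise only relevant on h(A). *)
Definition homeo_onto_image (S T : topologicalType) (A : set S) (h : S -> T) :=
  {within A, continuous h} /\
  exists2 g : T -> S, {within h @` A, continuous g} & {in A, cancel h g}.

(* The dimension is N = n.+1 >= 1, so that the last coordinate x_N exists and is
   x ord0 ord_max. The chart h is not part of the data. The pair (X, X^-) comes
   with the decomposition of X^- into its two sides X_l and X_r. *)
Record oriented_rectangle (R : realType) (Z : metricType R) (n : nat) :=
  OrientedRectangle {
    rect_set :> set Z ;
    rect_left : set Z ;
    rect_right : set Z ;
    rect_chart : exists h : 'rV[R]_n.+1 -> Z,
      [/\ homeo_onto_image (@unit_cube R n.+1) h,
          rect_set = h @` (@unit_cube R n.+1),
          rect_left = h @` [set x | unit_cube x /\ x ord0 ord_max = 0] &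
          rect_right = h @` [set x | unit_cube x /\ x ord0 ord_max = 1]]
  }.

Definition rect_minus (R : realType) (Z : metricType R) (n : nat)
    (X : oriented_rectangle Z n) : set Z :=
  rect_left X `|` rect_right X.

(* A path is defined on [curve_a, curve_b]; the values of curve_fun outside this
   interval are irrelevant. *)
Record curve (R : realType) (Z : metricType R) := Curve {
  curve_a : R ;
  curve_b : R ;
  curve_fun :> R -> Z ;
  curve_le : curve_a <= curve_b ;
  curve_continuous : {within `[curve_a, curve_b], continuous curve_fun}
}.

Definition curve_range (R : realType) (Z : metricType R) (gamma : curve Z) :
  set Z := gamma @` `[curve_a gamma, curve_b gamma].

Definition subcurve (R : realType) (Z : metricType R) (sigma gamma : curve Z) :=
  [/\ curve_a gamma <= curve_a sigma,
      curve_b sigma <= curve_b gamma &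
      forall t, t \in `[curve_a sigma, curve_b sigma] -> sigma t = gamma t].

(* A partial map Z >= Dpsi -> Z is given by its domain Dpsi and a total function
   psi whose values outside Dpsi are never used, since K is included in Dpsi. *)
Definition stretches (R : realType) (Z : metricType R) (n : nat)
    (Dpsi : set Z) (psi : Z -> Z) (D K : set Z)
    (X Y : oriented_rectangle Z n) : Prop :=
  [/\ D `<=` X `&` Dpsi,
      K `<=` D,
      compact K,
      {within K, continuous psi} &
      forall gamma : curve Z,
        curve_range gamma `<=` X ->
        curve_range gamma `&` rect_left X !=set0 ->
        curve_range gamma `&` rect_right X !=set0 ->
        exists sigma : curve Z,
          [/\ subcurve sigma gamma,
              curve_range sigma `<=` K,
              psi @` curve_range sigma `<=` Y,
              psi @` curve_range sigma `&` rect_left Y !=set0 &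
              psi @` curve_range sigma `&` rect_right Y !=set0]].

(* Main.v *)
(* Write phi for psi read in the chart of X, its coordinates being extended by
   Tietze's theorem to points where phi is not defined. A cubical degree argument
   shows that, if for each i closed sets A_i and B_i cover the cube and contain
   its faces x_i = 0 and x_i = 1 respectively, then all these sets have a common
   point. Applied to A_i = {phi_i >= x_i or x_i = 0} and B_i = {phi_i <= x_i or
   x_i = 1} for i < N and to a Urysohn separation in the last direction, this
   gives for every e a path from x_N = 0 to x_N = 1 that stays e-close to the
   intersection C of these A_i and B_i. By the stretching property, part of it
   lies in K and has an image crossing X, so by the intermediate value theorem it
   contains a point of K with phi_N = x_N. Compactness then yields such a point in
   C, which is fixed by phi. *)
Require Import Defs.
From mathcomp Require Import all_boot all_order all_algebra fingroup perm.
From mathcomp Require Import all_classical all_reals all_analysis.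
From mathcomp Require Import zify ring lra.

Set Implicit Arguments.
Unset Strict Implicit.

Import Order.TTheory GRing.Theory Num.Theory.
Import numFieldNormedType.Exports.

Local Open Scope ring_scope.

(** * Degree of grid labellings *)

(* A permutation [s] describes the monotone chain of vertices of the unit cube at
   [q] in which coordinate [i] is incremented at step [s i]; these chains are the
   simplices of Kuhn's triangulation. *)
Definition vertex N (q : {ffun 'I_N -> nat}) (s : 'S_N) (j : nat) :
  {ffun 'I_N -> nat} := [ffun i => (q i + (s i < j))%N].

Definition corner N p (q : {ffun 'I_N -> 'I_p}) : {ffun 'I_N -> nat} :=
  [ffun i => q i : nat].

(* The cup product of the coboundaries of the [f i], evaluated on a simplex. *)
Definition cup N (f : 'I_N -> {ffun 'I_N -> nat} -> int)
    (q : {ffun 'I_N -> nat}) (s : 'S_N) : int :=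
  \prod_i (f i (vertex q s i.+1) - f i (vertex q s i)).

(** The cup product evaluated on the fundamental chain of a grid with [p] cubes per direction;
    [(-1) ^+ s] is the orientation of a simplex. *)
Definition degree N p (f : 'I_N -> {ffun 'I_N -> nat} -> int) : int :=
  \sum_(q : {ffun 'I_N -> 'I_p}) \sum_(s : 'S_N) (-1) ^+ s * cup f (corner q) s.

(** A term of the summation by parts in factor [k]; [t] records along which edge of the chain each
    other factor is differenced, so that these edges can be moved. *)
Definition facet_term N (f : 'I_N -> {ffun 'I_N -> nat} -> int) (k : 'I_N)
    (e : nat) (t : 'I_N -> nat) (q : {ffun 'I_N -> nat}) (s : 'S_N) : int :=
  f k (vertex q s e) *
  \prod_(i | i != k) (f i (vertex q s (t i).+1) - f i (vertex q s (t i))).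

(** Pairing [s] with [s * t] shows that the sum equals its opposite. *)
Lemma sum_alternating N (Phi : 'S_N -> int) (t : 'S_N) :
  odd_perm t -> (forall s, Phi (s * t)%g = Phi s) ->
  \sum_(s : 'S_N) (-1) ^+ s * Phi s = 0.
Proof.
move=> todd Phit; set S := \sum_(s : 'S_N) _.
suff : S = - S by lia.
rewrite {1}/S (reindex_inj (mulIg t)) -sumrN; apply: eq_bigr => s _.
by rewrite Phit odd_permM todd addbT signrN mulNr.
Qed.

Lemma vertex_tperm N (q : {ffun 'I_N -> nat}) s (a b : 'I_N) (j : nat) :
  b = a.+1 :> nat -> j != b -> vertex q (s * tperm a b)%g j = vertex q s j.
Proof.
move=> ba jb; apply/ffunP => i; rewrite !ffunE permM.
by congr (_ + nat_of_bool _)%N; case: tpermP => [->|->|//]; lia.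
Qed.

(* Adding the two sides merges the factor [j] into [f j v_(m+1) - f j v_(m-1)],
   so that [v_m] no longer occurs; exchanging the steps [m-1] and [m] of the
   chain then reverses the sign of the sum. *)
Lemma face_shift N f (k j : 'I_N) (m e : nat) (t t' : 'I_N -> nat) q :
  j != k -> (0 < m < N)%N -> e != m -> t j = m -> (t' j).+1 = m ->
  (forall i, i != k -> i != j -> [/\ t i = t' i, t i != m & (t i).+1 != m]) ->
  \sum_(s : 'S_N) (-1) ^+ s * facet_term f k e t q s =
  - \sum_(s : 'S_N) (-1) ^+ s * facet_term f k e t' q s.
Proof.
move=> jk /andP[m0 mN] em tj tj' tt'.
apply/eqP; rewrite -addr_eq0 -big_split /=; apply/eqP.
have aN : (m.-1 < N)%N by lia.
pose a := Ordinal aN; pose b := Ordinal mN.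
have ba : b = a.+1 :> nat by rewrite /= prednK.
pose Phi s := f k (vertex q s e) *
  ((f j (vertex q s m.+1) - f j (vertex q s m.-1)) *
   \prod_(i | (i != k) && (i != j))
     (f i (vertex q s (t i).+1) - f i (vertex q s (t i)))).
rewrite (eq_bigr (fun s : 'S_N => (-1) ^+ s * Phi s)); last first.
  move=> s _; rewrite -mulrDr /facet_term /Phi; congr (_ * _).
  rewrite -mulrDr (bigD1 j) //= (bigD1 (P := fun i => i != k) j) //= tj tj'.
  have -> : t' j = m.-1 by lia.
  rewrite [X in _ + _ * X](eq_bigr
    (fun i => f i (vertex q s (t i).+1) - f i (vertex q s (t i)))); last first.
    by move=> i /andP[ik ij]; have [-> _ _] := tt' i ik ij.
  by ring.
apply: (@sum_alternating _ Phi (tperm a b)).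
  by rewrite odd_tperm -val_eqE /=; lia.
move=> s; rewrite /Phi !(vertex_tperm _ _ ba) //=; try lia.
congr (_ * (_ * _)); apply: eq_bigr => i /andP[ik ij].
by have [_ ? ?] := tt' i ik ij; rewrite !(vertex_tperm _ _ ba).
Qed.

(** Edge [k] of the chain is free. Factor [k + 1] moves into it, which frees edge [k + 1] for factor
    [k + 2], and so on; each move costs a sign. *)
Lemma face_shift_down N f (k : 'I_N) q d : (k + d < N)%N ->
  \sum_(s : 'S_N) (-1) ^+ s * facet_term f k k (fun i => i) q s =
  (-1) ^+ d * \sum_(s : 'S_N) (-1) ^+ s *
    facet_term f k k (fun i => if (k < i <= k + d)%N then i.-1 else i) q s.
Proof.
elim: d => [|d IHd] kd.
  rewrite mul1r; apply: eq_bigr => s _; congr (_ * (_ * _)).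
  by apply: eq_bigr => i _; rewrite ifF //; lia.
rewrite IHd; last by lia.
rewrite exprSr -mulrA mulN1r; congr (_ * _).
apply: (@face_shift _ _ _ (Ordinal kd) (k + d.+1)) => //=.
- by rewrite -val_eqE /=; lia.
- by lia.
- by lia.
- by rewrite ifF //; lia.
- by rewrite ifT; lia.
- move=> i; rewrite -!val_eqE /= => ik ij.
  by split; do ?case: ifP; lia.
Qed.

Lemma face_shift_up N f (k : 'I_N) q d : (d <= k)%N ->
  \sum_(s : 'S_N) (-1) ^+ s * facet_term f k k.+1 (fun i => i) q s =
  (-1) ^+ d * \sum_(s : 'S_N) (-1) ^+ s *
    facet_term f k k.+1 (fun i => if (k - d <= i < k)%N then i.+1 else i) q s.
Proof.
elim: d => [|d IHd] kd.
  rewrite mul1r; apply: eq_bigr => s _; congr (_ * (_ * _)).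
  by apply: eq_bigr => i _; rewrite ifF //; lia.
rewrite IHd; last by lia.
rewrite exprSr -mulrA mulN1r; congr (_ * _).
have jN : (k - d.+1 < N)%N by have := ltn_ord k; lia.
(* [face_shift] moves a factor downwards, so it is applied from the new position back to the old
   one. *)
apply/eqP; rewrite -eqr_oppLR; apply/eqP/esym.
apply: (@face_shift _ _ _ (Ordinal jN) (k - d)) => //=.
- by rewrite -val_eqE /=; lia.
- by have := ltn_ord k; lia.
- by lia.
- by rewrite ifT; lia.
- by rewrite ifF; lia.
- move=> i; rewrite -!val_eqE /= => ik ij.
  by split; do ?case: ifP; lia.
Qed.

(* The simplex [s] at [q] without its first vertex is the cyclically permuted
   simplex at its second vertex, without its last vertex. *)
Lemma vertex_cycle n (q : {ffun 'I_n.+1 -> nat}) s j : (j <= n)%N ->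
  vertex q s j.+1 = vertex (vertex q s 1) (s * lift_perm ord0 ord_max 1)%g j.
Proof.
move=> jn; apply/ffunP => i; rewrite !ffunE permM -addnA; congr (_ + _)%N.
case: (unliftP ord0 (s i)) => [l ->|->].
  rewrite lift_perm_lift perm1 /= /bump /=.
  by have := ltn_ord l; lia.
by rewrite lift_perm_id /=; lia.
Qed.

(** The cyclic shift of coordinate [a] reindexes the sum; it differs from the true shift only where
    it wraps around, and there both terms vanish. *)
Lemma sum_corner_shift N p (a : 'I_N) (H : {ffun 'I_N -> nat} -> int) :
  (forall x : {ffun 'I_N -> nat}, x a = 0%N \/ x a = p -> H x = 0) ->
  \sum_(q : {ffun 'I_N -> 'I_p}) H [ffun i => (q i + (i == a))%N] =
  \sum_(q : {ffun 'I_N -> 'I_p}) H (corner q).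
Proof.
move=> H0.
pose up (F : 'I_p -> 'I_p) (q : {ffun 'I_N -> 'I_p}) : {ffun 'I_N -> 'I_p} :=
  [ffun i => if i == a then F (q i) else q i].
have upK : cancel (up (@ordS p)) (up (@ord_pred p)).
  by move=> q; apply/ffunP => i; rewrite !ffunE; case: eqP => // _; rewrite ordSK.
rewrite [RHS](reindex_inj (can_inj upK)); apply: eq_bigr => q _ /=.
have [qp|qp] := eqVneq (q a).+1 p.
  rewrite !H0 //; first by left; rewrite !ffunE eqxx /= qp modnn.
  by right; rewrite ffunE eqxx addn1.
congr H; apply/ffunP => i; rewrite !ffunE; case: eqP => [->|_].
  by rewrite /= addn1 modn_small // ltn_neqAle qp ltn_ord.
by rewrite addn0.
Qed.

(* Summation by parts: the terms with [f k v_(k+1)] and those with [f k v_k] are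
   brought to opposite facets of the simplices, where they cancel, except on the
   boundary of the grid, where they are zero. *)
Lemma degree_vanish n p f (k : 'I_n.+1) :
  (forall i (x y : {ffun 'I_n.+1 -> nat}), i != k -> x i = 0%N -> y i = 0%N ->
    f i x = f i y) ->
  (forall i (x y : {ffun 'I_n.+1 -> nat}), i != k -> x i = p -> y i = p ->
    f i x = f i y) ->
  (forall x : {ffun 'I_n.+1 -> nat}, x k = 0%N \/ x k = p -> f k x = 0) ->
  degree p f = 0.
Proof.
move=> f0 fp fk.
pose down (i : 'I_n.+1) : nat := if (k < i)%N then i.-1 else i.
have kn := ltn_ord k.
have splitE q : \sum_(s : 'S_n.+1) (-1) ^+ s * cup f q s =
    \sum_(s : 'S_n.+1) (-1) ^+ s * facet_term f k k.+1 (fun i => i) q s -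
    \sum_(s : 'S_n.+1) (-1) ^+ s * facet_term f k k (fun i => i) q s.
  rewrite -sumrB; apply: eq_bigr => s _.
  by rewrite -mulrBr -mulrBl /cup (bigD1 k).
have downE q : \sum_(s : 'S_n.+1) (-1) ^+ s * facet_term f k k (fun i => i) q s =
    (-1) ^+ (n - k) * \sum_(s : 'S_n.+1) (-1) ^+ s * facet_term f k k down q s.
  rewrite (@face_shift_down _ _ _ _ (n - k)); last by lia.
  congr (_ * _); apply: eq_bigr => s _; congr (_ * (_ * _)).
  apply: eq_bigr => i _; suff -> : (k < i <= k + (n - k))%N = (k < i)%N by [].
  by have := ltn_ord i; lia.
(* The sign [(-1) ^+ n] of this cycle makes up for the [k] moves upwards against the [n - k] moves
   downwards. *)
pose c : 'S_n.+1 := lift_perm ord0 ord_max 1.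
have c_odd : odd_perm c = odd n by rewrite odd_lift_perm odd_perm1 /= addbF.
have upE q : \sum_(s : 'S_n.+1) (-1) ^+ s * facet_term f k k.+1 (fun i => i) q s =
    (-1) ^+ (n - k) *
    \sum_(s : 'S_n.+1) (-1) ^+ (s * c)%g *
      facet_term f k k down (vertex q s 1) (s * c)%g.
  rewrite (@face_shift_up _ _ _ _ k) // !big_distrr /=; apply: eq_bigr => s _.
  have sgn_c : (-1) ^+ k * (-1) ^+ s = (-1) ^+ (n - k) * (-1) ^+ (s * c)%g :> int.
    rewrite odd_permM c_odd signr_addb signr_odd [LHS]mulrC [RHS]mulrCA.
    congr (_ * _); rewrite -exprD -signr_odd -[RHS]signr_odd.
    by congr (_ ^+ nat_of_bool _); lia.
  rewrite [LHS]mulrA [RHS]mulrA sgn_c; congr (_ * _).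
  rewrite /facet_term (@vertex_cycle _ _ _ k) //; congr (_ * _).
  apply: eq_bigr => i ik; have {}ik : (i : nat) != k by rewrite val_eqE.
  have -> : (if (k - k <= i < k)%N then i.+1 else i) = (down i).+1.
    by rewrite /down; do !case: ifP; lia.
  have dn : ((down i).+1 <= n)%N by rewrite /down; have := ltn_ord i; case: ifP; lia.
  by rewrite (@vertex_cycle _ q s _ dn) (@vertex_cycle _ q s _ (ltnW dn)).
rewrite /degree; under eq_bigr do rewrite splitE upE downE -mulrBr.
rewrite -big_distrr /= sumrB; apply/eqP; rewrite mulf_eq0; apply/orP; right.
rewrite subr_eq0; apply/eqP.
rewrite exchange_big [RHS]exchange_big /= [RHS](reindex_inj (mulIg c)) /=.
apply: eq_bigr => s _; rewrite -!big_distrr /=; congr (_ * _).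
(* Coordinate [a] is incremented first by [s] and last by [s * c]. So the second vertex is [q] moved
   by one along [a], and for a corner [x] with [x a] equal to [0] or [p] the facet lies in a face of
   the grid, where factor [a] kills the term. *)
pose a := (s^-1)%g ord0.
have sca : (s * c)%g a = ord_max by rewrite permM /a permKV lift_perm_id.
rewrite -(@sum_corner_shift _ p a
  (fun x => facet_term f k k down x (s * c)%g)); last first.
  move=> x xa; rewrite /facet_term.
  have va j : (j <= n)%N -> vertex x (s * c)%g j a = x a.
    by move=> jn; rewrite ffunE sca /= ltnNge jn addn0.
  have [ak|ak] := eqVneq a k.
    by rewrite fk ?mul0r //; move: xa; rewrite -(va k) ?ak.
  rewrite (bigD1 a) //= (_ : f a _ = f a (vertex x (s * c)%g (down a))).
    by rewrite subrr mul0r mulr0.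
  have {}ak : (a : nat) != k by rewrite val_eqE.
  have an : ((down a).+1 <= n)%N by rewrite /down; have := ltn_ord a; case: ifP; lia.
  by case: xa => xa; [apply: f0|apply: fp]; rewrite ?va // ltnW.
apply: eq_bigr => q _; congr facet_term; apply/ffunP => i; rewrite !ffunE.
congr (_ + nat_of_bool _)%N; rewrite ltnS leqn0 /a.
apply/eqP/eqP => [si|->]; last by rewrite permKV.
by apply: (@perm_inj _ s); rewrite permKV; apply: val_inj.
Qed.

(** The [f i] are replaced by the [g i] one at a time. By multilinearity, each replacement changes
    the degree by that of a family containing [f i - g i], which vanishes on both faces, so
    [degree_vanish] applies. *)
Lemma degree_const n p (f g : 'I_n.+1 -> {ffun 'I_n.+1 -> nat} -> int) :
  (forall i (x y : {ffun 'I_n.+1 -> nat}), x i = 0%N -> y i = 0%N ->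
    f i x = g i y) ->
  (forall i (x y : {ffun 'I_n.+1 -> nat}), x i = p -> y i = p -> f i x = g i y) ->
  degree p f = degree p g.
Proof.
move=> fg0 fgp.
pose h d (i : 'I_n.+1) := if (i < d)%N then g i else f i.
suff hE d : (d <= n.+1)%N -> degree p f = degree p (h d).
  rewrite (hE n.+1) //; apply: eq_bigr => q _; apply: eq_bigr => s _.
  congr (_ * _); apply: eq_bigr => i _.
  by rewrite /h ltn_ord.
elim: d => [//|d IHd dn]; rewrite IHd; last exact: ltnW.
pose k' := Ordinal dn.
pose w (i : 'I_n.+1) := if i == k' then fun x => f i x - g i x else h d i.
apply/eqP; rewrite -subr_eq0; apply/eqP.
rewrite -(@degree_vanish n p w k').
- rewrite /degree -sumrB; apply: eq_bigr => q _.
  rewrite -sumrB; apply: eq_bigr => s _; rewrite -mulrBr; congr (_ * _).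
  have cupE F : (forall i, i != k' -> F i = w i) ->
      cup F (corner q) s = (F k' (vertex (corner q) s d.+1) -
        F k' (vertex (corner q) s d)) * \prod_(i | i != k')
          (w i (vertex (corner q) s i.+1) - w i (vertex (corner q) s i)).
    move=> Fw; rewrite /cup (bigD1 k') //; congr (_ * _).
    by apply: eq_bigr => i ik; rewrite Fw.
  rewrite (cupE w) // (cupE (h d)) => [|i /negPf ik]; last by rewrite /w ik.
  rewrite (cupE (h d.+1)) => [|i /negPf ik].
    by rewrite /w eqxx /h /= ltnn ltnSn; ring.
  by rewrite -val_eqE /= in ik; rewrite /w -val_eqE /= ik /h ltnS leq_eqVlt ik.
- move=> i x y /negPf ik x0 y0; rewrite /w ik /h; case: ifP => _.
    by rewrite -(fg0 i x x) // (fg0 i x y).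
  by rewrite (fg0 i x y) // (fg0 i y y).
- move=> i x y /negPf ik x0 y0; rewrite /w ik /h; case: ifP => _.
    by rewrite -(fgp i x x) // (fgp i x y).
  by rewrite (fgp i x y) // (fgp i y y).
- by move=> x [x0|xp]; rewrite /w eqxx; apply/eqP; rewrite subr_eq0; apply/eqP; auto.
Qed.

(** Only the identity chain at the origin contributes: on any other cube some label is constantly 1,
    and at the origin factor [i] is nonzero only if [s i = i]. *)
Lemma degree_step n p : (0 < p)%N ->
  degree p (fun (i : 'I_n.+1) x => (0 < x i)%N%:Z) = 1.
Proof.
case: p => // p _.
rewrite /degree (bigD1 [ffun => ord0]) //= [X in _ + X]big1 ?addr0; last first.
  move=> q q0; apply: big1 => s _.
  have [i qi] : exists i, q i != ord0.
    apply/existsP; apply: contraR q0; rewrite negb_exists => /forallP q0.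
    by apply/eqP/ffunP => i; rewrite ffunE; apply/eqP; rewrite -[_ == _]negbK.
  rewrite /cup (bigD1 i) //= !ffunE.
  have qi0 : (0 < q i)%N by rewrite lt0n.
  by rewrite !addn_gt0 qi0 subrr mul0r mulr0.
rewrite (bigD1 1%g) //= [X in _ + X]big1 ?addr0; last first.
  move=> s s1; have [i si] : exists i, s i != i.
    apply/existsP; apply: contraR s1; rewrite negb_exists => /forallP s1.
    by apply/eqP/permP => i; rewrite perm1; apply/eqP; rewrite -[_ == _]negbK.
  rewrite /cup (bigD1 i) //= !ffunE /= !add0n !lt0b ltnS.
  by rewrite [(s i <= i)%N]leq_eqVlt val_eqE (negPf si) subrr mul0r mulr0.
rewrite odd_perm1 mul1r /cup big1 // => i _.
by rewrite !ffunE perm1 /= !add0n !lt0b ltnSn ltnn.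
Qed.

(** The labels have the degree of the step labels, which is 1. Hence some simplex has a nonzero cup
    product, and every label changes along one of its edges. *)
Lemma kuhn_labelling n p (l : 'I_n.+1 -> {ffun 'I_n.+1 -> nat} -> bool) :
  (0 < p)%N ->
  (forall i (x : {ffun 'I_n.+1 -> nat}), x i = 0%N -> l i x = false) ->
  (forall i (x : {ffun 'I_n.+1 -> nat}), x i = p -> l i x = true) ->
  exists2 q : {ffun 'I_n.+1 -> nat}, (forall i, q i < p)%N &
    forall i (b : bool), exists2 x : {ffun 'I_n.+1 -> nat},
      (forall j, q j <= x j <= (q j).+1)%N & l i x = b.
Proof.
move=> p0 l0 lp.
have : degree p (fun i x => (l i x)%:Z) != 0.
  rewrite (degree_const (g := fun (i : 'I_n.+1) x => (0 < x i)%N%:Z));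
    rewrite ?degree_step //.
  - by move=> i x y x0 y0; rewrite l0 // y0.
  - by move=> i x y xp yp; rewrite lp // yp p0.
move=> deg_neq0.
have [q /existsP[s qs]] : exists q : {ffun 'I_n.+1 -> 'I_p},
    [exists s : 'S_n.+1, cup (fun i x => (l i x)%:Z) (corner q) s != 0].
  apply/existsP; apply: contraR deg_neq0; rewrite negb_exists => /forallP qs.
  apply/eqP/big1 => q _; apply: big1 => s _.
  by have := qs q; rewrite negb_exists => /forallP/(_ s);
    rewrite negbK => /eqP ->; rewrite mulr0.
exists (corner q) => [i|i b]; first by rewrite ffunE.
have /prodf_neq0/(_ i isT) li := qs.
have vP j m : (corner q m <= vertex (corner q) s j m <= (corner q m).+1)%N.
  by rewrite [vertex _ _ _ _]ffunE; case: (_ < _)%N; lia.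
have [lb|lb] := eqVneq (l i (vertex (corner q) s i.+1)) b.
  by exists (vertex (corner q) s i.+1).
exists (vertex (corner q) s i) => //; move: li lb.
by case: (l i _); case: (l i _); case: b.
Qed.

(** * Closed covers of the cube *)

Local Open Scope classical_set_scope.
Local Open Scope ring_scope.

Lemma closed_approx (R : realType) (V : normedModType R) (A : set V) (x : V) :
  closed A -> (forall e, 0 < e -> exists2 y, A y & `|x - y| < e) -> A x.
Proof.
move=> cA Ae; apply: cA => B /nbhs_normP[e e0 eB].
by have [y Ay xy] := Ae e e0; exists y; split => //; apply: eB.
Qed.

Lemma compact_limit_point (R : realType) (V : normedModType R) (Q : set V)
    (u : nat -> V) : compact Q -> (forall m, Q (u m)) ->
  exists x, Q x /\ forall e, 0 < e -> exists m, m.+1%:R^-1 < e /\ `|x - u m| < e.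
Proof.
move=> cQ uQ; have [|x [Qx xu]] := cQ (u @ \oo) _.
  by exists 0%N => // m _; apply: uQ.
exists x; split => // e e0.
have [||_ [[m me <-] xm]] := xu (u @` [set m | m.+1%:R^-1 < e]) (ball x e).
- by apply: filterS (near_infty_natSinv_lt (PosNum e0)) => m me; exists m.
- exact: nbhsx_ballx.
by exists m; split => //; move: xm; rewrite -ball_normE.
Qed.

Lemma compact_closed_meet (R : realType) (V : normedModType R) (Q C : set V) :
  compact Q -> closed C ->
  (forall e, 0 < e -> exists x c, [/\ Q x, C c & `|x - c| < e]) ->
  Q `&` C !=set0.
Proof.
move=> cQ cC QC.
have /choice[u uE] : forall m : nat, exists x,
    Q x /\ exists2 c, C c & `|x - c| < m.+1%:R^-1.
  move=> m; have [|x [c [Qx Cc xc]]] := QC (m.+1%:R^-1).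
    by rewrite invr_gt0 ltr0n.
  by exists x; split => //; exists c.
have [m|x [Qx xu]] := @compact_limit_point _ _ _ u cQ; first by have [] := uE m.
exists x; split => //; apply: closed_approx => // e e0.
have [m [me xm]] := xu _ (divr_gt0 e0 (ltr0n R 2)).
have [_ [c Cc uc]] := uE m; exists c => //.
rewrite -(subrK (u m) x) -addrA (le_lt_trans (ler_normD _ _)) //.
by rewrite [e]splitr ltrD // (lt_trans uc).
Qed.

Lemma rV_norm_le (R : realType) N (x : 'rV[R]_N) (e : R) :
  0 <= e -> (forall i, `|x ord0 i| <= e) -> `|x| <= e.
Proof.
move=> e0 xe; rewrite [leLHS]/Num.norm /= mx_normrE; apply: bigmax_le => // -[i j] _.
by rewrite ord1.
Qed.

Lemma unit_cube_compact (R : realType) N : compact (@unit_cube R N).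
Proof.
apply: bounded_closed_compact.
  exists 1; split; [exact: num_real|move=> e e1 x xc].
  apply: le_trans (ltW e1); apply: rV_norm_le => // i.
  by have /andP[x0 x1] := xc i; rewrite ger0_norm.
rewrite (_ : @unit_cube R N = \bigcap_(i in [set: 'I_N])
    ((fun x : 'rV[R]_N => x ord0 i) @^-1` `[0, 1]%classic)).
  apply: closed_bigI => i _; apply: preimage_closed; last exact: interval_closed.
  by move=> x _; apply: coord_continuous.
by apply/seteqP; split => x xc i; have := xc i; rewrite /= ?in_itv //=; auto.
Qed.

Lemma unit_cube_closed (R : realType) N : closed (@unit_cube R N).
Proof. by apply: compact_closed (@unit_cube_compact R N); apply: norm_hausdorff. Qed.

Section cube_cover.
Variables (R : realType) (n : nat) (A B : 'I_n.+1 -> set 'rV[R]_n.+1).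
Hypothesis AB : forall i, @unit_cube R n.+1 `<=` A i `|` B i.
Hypothesis A0 : forall i x, unit_cube x -> x ord0 i = 0 -> A i x.
Hypothesis B1 : forall i x, unit_cube x -> x ord0 i = 1 -> B i x.

Lemma cube_cover_approx (m : nat) : exists2 u, unit_cube u &
  forall i, (exists2 a, A i a & `|u - a| <= m.+1%:R^-1) /\
            (exists2 b, B i b & `|u - b| <= m.+1%:R^-1).
Proof.
pose p := m.+1; have p0 : 0 < p%:R :> R by rewrite ltr0n.
pose pt (x : {ffun 'I_n.+1 -> nat}) : 'rV[R]_n.+1 := \row_i ((x i)%:R / p%:R).
have pt_cube (x : {ffun 'I_n.+1 -> nat}) :
    (forall i, (x i <= p)%N) -> unit_cube (pt x).
  move=> xp i; rewrite mxE divr_ge0 ?ler0n //=.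
  by rewrite ler_pdivrMr // mul1r ler_nat.
(* The values at [x i = p] and [x i = 0] are forced, to fit [kuhn_labelling]. On the cube, true
   still implies [B i] and false [A i], by [B1], [A0] and the cover. *)
pose l i (x : {ffun 'I_n.+1 -> nat}) :=
  (x i == p) || ((0 < x i)%N && `[<B i (pt x)>]).
have [i x x0|i x xp|q qp ql] := @kuhn_labelling n p l isT.
- by rewrite /l x0.
- by rewrite /l xp eqxx.
exists (pt q); first by apply: pt_cube => i; apply: ltnW.
have near_pt (x : {ffun 'I_n.+1 -> nat}) :
    (forall j, q j <= x j <= (q j).+1)%N -> `|pt q - pt x| <= p%:R^-1.
  move=> qx; apply: rV_norm_le => [|i]; first by rewrite invr_ge0 ltW.
  rewrite !mxE -mulrBl normrM [`|_^-1|]gtr0_norm ?invr_gt0 //.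
  rewrite ler_piMl ?invr_ge0 ?(ltW p0) // distrC.
  have /andP[qi xi] := qx i; rewrite -natrB // normr_nat.
  by rewrite (ler_nat _ _ 1); lia.
have le_p (x : {ffun 'I_n.+1 -> nat}) :
    (forall j, q j <= x j <= (q j).+1)%N -> forall i, (x i <= p)%N.
  by move=> qx i; have /andP[_ /leq_trans] := qx i; apply; apply: qp.
move=> i; split.
- have [x qx lx] := ql i false; exists (pt x); last exact: near_pt.
  have cx := pt_cube _ (le_p _ qx).
  move: lx; rewrite /l => /negbT; rewrite negb_or => /andP[xp].
  rewrite negb_and -leqNgt leqn0 => /orP[/eqP x0|/asboolPn nB].
    by apply: A0 => //; rewrite mxE x0 mul0r.
  by have [] := @AB i (pt x) cx.
- have [x qx lx] := ql i true; exists (pt x); last exact: near_pt.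
  have cx := pt_cube _ (le_p _ qx).
  move: lx; rewrite /l => /orP[/eqP xp|/andP[_ /asboolP//]].
  by apply: B1 => //; rewrite mxE xp divff // lt0r_neq0.
Qed.

Hypothesis A_closed : forall i, closed (A i).
Hypothesis B_closed : forall i, closed (B i).

(** The approximate common points accumulate in the compact cube, and closedness puts the limit into
    every set. *)
Lemma cube_cover : exists2 x, unit_cube x & forall i, A i x /\ B i x.
Proof.
have /choice[u uE] : forall m, exists u, unit_cube u /\
  forall i, (exists2 a, A i a & `|u - a| <= m.+1%:R^-1) /\
            (exists2 b, B i b & `|u - b| <= m.+1%:R^-1).
  by move=> m; have [v ? ?] := cube_cover_approx m; exists v.
have [|x [xc nearu]] := @compact_limit_point _ _ _ u (@unit_cube_compact R n.+1).
  by move=> m; have [] := uE m.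
have near_trans e m (a : 'rV[R]_n.+1) : m.+1%:R^-1 < e / 2 ->
    `|x - u m| < e / 2 -> `|u m - a| <= m.+1%:R^-1 -> `|x - a| < e.
  move=> me xm ua; rewrite -(subrK (u m) x) -addrA (le_lt_trans (ler_normD _ _)) //.
  by rewrite [e]splitr ltrD // (le_lt_trans ua).
exists x => // i; split; apply: closed_approx => // e e0.
- have [m [me xm]] := nearu _ (divr_gt0 e0 (ltr0n R 2)).
  have [_ /(_ i)[[a Aa ua] _]] := uE m; exists a => //.
  exact: near_trans ua.
- have [m [me xm]] := nearu _ (divr_gt0 e0 (ltr0n R 2)).
  have [_ /(_ i)[_ [b Bb ub]]] := uE m; exists b => //.
  exact: near_trans ub.
Qed.

End cube_cover.

(** * Paths across the cube *)

(* The path is parametrised by [0, +oo[ and is eventually constant, which makes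
   it possible to extend it by adding a segment. *)
Definition joined (R : realType) (V : normedModType R) (U : set V) (x y : V) :=
  exists T (g : R -> V), [/\ 0 <= T, continuous g, g 0 = x,
    (forall t, T <= t -> g t = y) & forall t, 0 <= t -> U (g t)].

Lemma joined_refl (R : realType) (V : normedModType R) (U : set V) x :
  U x -> joined U x x.
Proof.
by move=> Ux; exists 0, (fun=> x); split => // t; apply: cst_continuous.
Qed.

Lemma joined_segment (R : realType) (V : normedModType R) (U : set V) x y z :
  joined U x y -> (forall c, 0 <= c <= 1 -> U (y + c *: (z - y))) ->
  joined U x z.
Proof.
move=> [T [g [T0 cg g0 gT gU]]] yz.
(* [clamp] rises from 0 to 1 on [[T, T + 1]], where [g] already rests at [y]. *)
pose clamp (t : R) : R := Num.max 0 (Num.min 1 (t - T)).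
have clamp01 t : 0 <= clamp t <= 1.
  by rewrite /clamp le_max lexx ge_max ler01 ge_min lexx.
have clampT t : t <= T -> clamp t = 0.
  move=> tT; rewrite /clamp; apply/max_idPl.
  by rewrite ge_min subr_le0 tT orbT.
exists (T + 1), (fun t => g t + clamp t *: (z - y)); split.
- by rewrite addr_ge0.
- move=> t; apply: (@continuousD _ _ _ g (fun t => clamp t *: (z - y))).
    exact: cg.
  apply: continuousZ; last exact: cst_continuous.
  apply: (@continuous_max _ _ (cst 0)); first exact: cst_continuous.
  apply: (@continuous_min _ _ (cst 1)); first exact: cst_continuous.
  apply: (@continuousB _ _ _ id (cst T)); first by move=> ?.
  exact: cst_continuous.
- by rewrite clampT // scale0r addr0.
- move=> t Tt; rewrite gT; last by rewrite (le_trans _ Tt) // lerDl.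
  have -> : clamp t = 1.
    rewrite /clamp (min_idPl _); last by lra.
    by apply/max_idPr.
  by rewrite scale1r addrC subrK.
- move=> t t0; have [tT|Tt] := leP t T.
    by rewrite clampT // scale0r addr0; apply: gU.
  by rewrite gT ?(ltW Tt) //; apply: yz.
Qed.

Lemma unit_cube_segment (R : realType) N (y z : 'rV[R]_N) (c : R) :
  unit_cube y -> unit_cube z -> 0 <= c <= 1 -> unit_cube (y + c *: (z - y)).
Proof.
move=> yc zc /andP[c0 c1] i; rewrite !mxE.
have /andP[y0 y1] := yc i; have /andP[z0 z1] := zc i.
by apply/andP; split; nra.
Qed.

Lemma closed_coord (R : realType) N (i : 'I_N) (a : R) :
  closed [set x : 'rV[R]_N | x ord0 i = a].
Proof.
apply: (@preimage_closed _ _ (fun x : 'rV[R]_N => x ord0 i) [set a]).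
  by move=> x _; apply: coord_continuous.
exact: closed_eq.
Qed.

(* The points of the common part [C] that an [e]-thin path joins to the bottom
   and the remaining ones are closed sets; if the former avoided the top, they
   could be separated by a Urysohn function, whose sub- and superlevel sets
   would be a last pair of sets contradicting [cube_cover]. *)
Lemma crossing_path (R : realType) n (A B : 'I_n.+1 -> set 'rV[R]_n.+1) (e : R) :
  0 < e ->
  (forall i, closed (A i)) -> (forall i, closed (B i)) ->
  (forall i, @unit_cube R n.+1 `<=` A i `|` B i) ->
  (forall i x, unit_cube x -> x ord0 i = 0 -> A i x) ->
  (forall i x, unit_cube x -> x ord0 i = 1 -> B i x) ->
  exists T (g : R -> 'rV[R]_n.+1), [/\ 0 <= T, continuous g,
    g 0 ord0 ord_max = 0, g T ord0 ord_max = 1 &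
    forall t, 0 <= t -> unit_cube (g t) /\
      exists c, [/\ unit_cube c, forall i, i != ord_max -> A i c /\ B i c &
                    `|g t - c| < e]].
Proof.
move=> e0 cA cB AB A0 B1.
pose C := [set c : 'rV[R]_n.+1 |
  unit_cube c /\ forall i, i != ord_max -> A i c /\ B i c].
pose U := [set x : 'rV[R]_n.+1 | unit_cube x /\ exists2 c, C c & `|x - c| < e].
have CU x : C x -> U x.
  by move=> Cx; split; [case: Cx|exists x => //; rewrite subrr normr0].
have C_closed : closed C.
  rewrite (_ : C = @unit_cube R n.+1 `&`
      \bigcap_(i in [set i : 'I_n.+1 | i != ord_max]) (A i `&` B i)).
    apply: closedI; first exact: unit_cube_closed.
    by apply: closed_bigI => i _; apply: closedI.
  by apply/seteqP; split => x [xc xAB]; split => // i /xAB.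
pose C1 := [set y | C y /\
  exists x : 'rV[R]_n.+1, x ord0 ord_max = 0 /\ joined U x y].
(* The segment from [y] to [z] stays in the convex cube and [e]-close to [y], a point of [C]. *)
have C1_near y z : C1 y -> C z -> `|y - z| < e -> C1 z.
  move=> [Cy [x [x0 xy]]] Cz yz; split => //; exists x; split => //.
  apply: joined_segment xy _ => c c01; split.
    by apply: unit_cube_segment => //; [case: Cy|case: Cz].
  exists y => //; rewrite addrAC subrr add0r normrZ.
  case/andP: c01 => c0 c1; rewrite ger0_norm // distrC.
  by rewrite (le_lt_trans _ yz) // ler_piMl.
pose C2 := C `\` C1.
(* By [C1_near], points of [C] less than [e] apart lie both in [C1] or both in [C2], so these sets
   inherit closedness from [C]. *)
have C1_closed : closed C1.
  move=> x xC1; have Cx : C x.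
    by apply: C_closed; apply: closureS xC1 => y [].
  have [y [C1y xy]] := xC1 _ (nbhsx_ballx x e e0).
  by apply: C1_near C1y Cx _; move: xy; rewrite -ball_normE /= distrC.
have C2_closed : closed C2.
  move=> x xC2; have Cx : C x.
    by apply: C_closed; apply: closureS xC2 => y [].
  split=> // C1x; have [y [[Cy nC1y] xy]] := xC2 _ (nbhsx_ballx x e e0).
  by apply/nC1y/(C1_near _ _ C1x Cy); move: xy; rewrite -ball_normE.
have [[y [[Cy [x [x0 [T [g [T0 cg g0 gT gU]]]]]] y1]]|no_path] :=
    pselect (exists y, C1 y /\ y ord0 ord_max = 1).
  exists T, g; split => //; rewrite ?g0 ?gT // => t /gU [gc [c [cc cAB] gtc]].
  by split => //; exists c.
pose L := [set x : 'rV[R]_n.+1 | x ord0 ord_max = 0].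
pose H := [set x : 'rV[R]_n.+1 | x ord0 ord_max = 1].
have sep : uniform_separator (C1 `|` L) (C2 `|` H).
  move/(@normal_separatorP R): (@pseudometric_normal R 'rV[R]_n.+1); apply.
  - by apply: closedU => //; apply: closed_coord.
  - by apply: closedU => //; apply: closed_coord.
  (* A point of [C] at the bottom is in [C1] through a constant path, and [C1] avoids the top. *)
  apply/seteqP; split => // x [[C1x|Lx] [[Cx nC1x]|Hx]].
  - exact: nC1x.
  - by apply: no_path; exists x.
  - by apply: nC1x; split => //; exists x; split => //; apply/joined_refl/CU.
  - by move: Lx; rewrite /L /= Hx => /eqP; rewrite oner_eq0.
move/(@uniform_separatorP _ R): sep => [u [cu _ u0 u1]].
have u0E x : (C1 `|` L) x -> u x = 0 by move=> ?; apply: u0; exists x.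
have u1E x : (C2 `|` H) x -> u x = 1 by move=> ?; apply: u1; exists x.
pose A' i := if i == ord_max then [set x | u x <= 1 / 2] else A i.
pose B' i := if i == ord_max then [set x | 1 / 2 <= u x] else B i.
have [|||||x xc xAB] := @cube_cover R n A' B'.
- move=> i x xc; rewrite /A' /B'; case: ifP => _; last exact: AB.
  by case: (leP (u x) (1 / 2)) => [|/ltW]; [left|right].
- move=> i x xc xi; rewrite /A'; case: eqP xi => [-> xi|_ xi]; last exact: A0.
  by rewrite /= u0E; [lra|right].
- move=> i x xc xi; rewrite /B'; case: eqP xi => [-> xi|_ xi]; last exact: B1.
  by rewrite /= u1E; [lra|right].
- move=> i; rewrite /A'; case: ifP => _ //.
  apply: (@preimage_closed _ _ u [set x | x <= 1 / 2]); last exact: closed_le.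
  by move=> x _; apply: cu.
- move=> i; rewrite /B'; case: ifP => _ //.
  apply: (@preimage_closed _ _ u [set x | 1 / 2 <= x]); last exact: closed_ge.
  by move=> x _; apply: cu.
(* The common point lies in [C], hence in [C1] or [C2], where [u] is 0 or 1, whereas the last pair
   of sets forces [u x = 1 / 2]. *)
have Cx : C x by split => // i /negPf im; have := xAB i; rewrite /A' /B' im.
have := xAB ord_max; rewrite /A' /B' eqxx /= => -[ux2 u2x].
have [C1x|nC1x] := pselect (C1 x).
  by move: u2x; rewrite u0E; [lra|left].
by move: ux2; rewrite u1E; [lra|left].
Qed.

(** * The fixed point *)

Lemma within_continuous_closed (S T : topologicalType) (A : set S) (B : set T)
    (f : S -> T) :
  closed A -> {within A, continuous f} -> closed B -> closed (A `&` f @^-1` B).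
Proof.
move=> cA /continuous_closedP/(_ B) cf cB.
have /closed_subspaceP[V cV VA] := cf cB.
by rewrite setIC -VA; apply: closedI.
Qed.

Lemma within_continuous_comp_sub (S T U : topologicalType) (A : set S)
    (B : set T) (f : S -> T) (k : T -> U) :
  {within A, continuous f} -> (forall x, A x -> B (f x)) ->
  {within B, continuous k} -> {within A, continuous (k \o f)}.
Proof.
move=> /subspace_continuousP cf AB /subspace_continuousP ck.
apply/subspace_continuousP => x Ax W /(ck _ (AB _ Ax)) kW.
have := cf _ Ax _ kW; rewrite /= !nbhs_simpl /= /within /=.
by apply: filterS => y fW Ay; apply: fW => //; apply: AB.
Qed.

Theorem theorem5p1 (R : realType) (Z : metricType R) (n : nat)
    (X : oriented_rectangle Z n) (Dpsi : set Z) (psi : Z -> Z)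
    (D : set Z) (hD : D `<=` X `&` Dpsi)
    (K : set Z) (hK : compact K) (hKD : K `<=` D)
    (hstretch : stretches Dpsi psi D K X X) :
  exists w : Z, K w /\ psi w = w.
Proof.
case: hstretch => _ _ _ psiK str.
have [h [[hc [g gc gK]] XE LE RE]] := rect_chart X.
set Q := @unit_cube R n.+1.
have Q_compact : compact Q by apply: unit_cube_compact.
have Q_closed : closed Q by apply: unit_cube_closed.
have {}gK x : Q x -> g (h x) = x by move=> Qx; apply: gK; rewrite inE.
have X_closed : closed X.
  by rewrite XE; apply: compact_closed;
    [exact: metric_hausdorff|exact: continuous_compact].
have K_closed : closed K by apply: compact_closed => //; exact: metric_hausdorff.
pose K1 := Q `&` h @^-1` K.
have K1_closed : closed K1 by apply: within_continuous_closed.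
have psih : {within K1, continuous (psi \o h)}.
  apply: (within_continuous_comp_sub (B := K)) => // [|x []//].
  by apply: continuous_subspaceW hc => x [].
(* Here the image under [psi] lies in [X], where [g] inverts the chart, so [phi] is continuous on
   [K'] with values in the cube. *)
pose K' := K1 `&` (psi \o h) @^-1` X.
have K'_closed : closed K' by apply: within_continuous_closed.
pose phi : 'rV[R]_n.+1 -> 'rV[R]_n.+1 := g \o (psi \o h).
have phi_cont : {within K', continuous phi}.
  apply: (within_continuous_comp_sub (B := h @` Q)) => //.
    by apply: continuous_subspaceW psih => x [].
  by move=> x [_]; rewrite -XE.
have phiE x : K' x -> Q (phi x) /\ h (phi x) = psi (h x).
  by case=> _; rewrite /= XE => -[y Qy yE]; rewrite /phi /= -yE gK.
have K'Q x : K' x -> Q x by case=> -[].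
have /choice[G GE] : forall i : 'I_n.+1, exists Gi : 'rV[R]_n.+1 -> R,
    continuous Gi /\ forall x, K' x -> Gi x = phi x ord0 i.
  move=> i; have [||Gi [GiE Gic _]] := @continuous_bounded_extension
    'rV[R]_n.+1 R pseudometric_normal K' K'_closed (fun x => phi x ord0 i) 1 ltr01.
  - move=> x; apply: (@continuous_comp (subspace K') _ _ phi (fun v => v ord0 i)).
      exact: phi_cont.
    exact: coord_continuous.
  - move=> x K'x; have [/(_ i)/andP[p0 p1] _] := phiE x K'x.
    by rewrite ger0_norm.
  by exists Gi; split => // x K'x; rewrite GiE // inE.
have Gc i : continuous (G i) by have [] := GE i.
have {}GE i x : K' x -> G i x = phi x ord0 i by have [_] := GE i; apply.
pose F i (x : 'rV[R]_n.+1) : R := G i x - x ord0 i.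
have Fc i : continuous (F i).
  move=> x; apply: (@continuousB _ _ _ (G i) (fun x => x ord0 i)).
    exact: Gc.
  exact: coord_continuous.
pose A i := [set x | 0 <= F i x] `|` [set x : 'rV[R]_n.+1 | x ord0 i = 0].
pose B i := [set x | F i x <= 0] `|` [set x : 'rV[R]_n.+1 | x ord0 i = 1].
have A_closed i : closed (A i).
  apply: closedU; last exact: closed_coord.
  by apply: (@preimage_closed _ _ (F i) [set y | 0 <= y]) => [? _|];
    [exact: Fc|exact: closed_ge].
have B_closed i : closed (B i).
  apply: closedU; last exact: closed_coord.
  by apply: (@preimage_closed _ _ (F i) [set y | y <= 0]) => [? _|];
    [exact: Fc|exact: closed_le].
(* As [x] and [phi x] are in the cube, [F i x] is nonnegative on the face [x_i = 0] and nonpositive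
   on [x_i = 1], so the faces added to [A i] and [B i] do no harm. *)
have AB_zero i x : K' x -> A i x -> B i x -> F i x = 0.
  move=> K'x; have /(_ i)/andP[x0 x1] := K'Q _ K'x.
  have [/(_ i)/andP[p0 p1] _] := phiE x K'x.
  rewrite /A /B /F /= GE // => -[a|a] [b|b]; lra.
pose K2 := K' `&` [set x | F ord_max x = 0].
pose C := \bigcap_(i in [set i : 'I_n.+1 | i != ord_max]) (A i `&` B i).
suff [x [[K'x xmax] Cx]] : K2 `&` C !=set0.
  exists (h x); split; first by case: K'x => -[].
  have [Qphi <-] := phiE x K'x; congr h; apply/rowP => i.
  rewrite -GE //; apply/eqP; rewrite -subr_eq0; apply/eqP.
  have [->//|im] := eqVneq i ord_max.
  by have [] := Cx i im; apply: AB_zero.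
(* It remains to find points of the compact [K2] arbitrarily close to the closed [C]. *)
apply: compact_closed_meet.
- apply: subclosed_compact Q_compact _ => [|x [/K'Q]//].
  apply: closedI => //.
  apply: (@preimage_closed _ _ (F ord_max) [set 0]); last exact: closed_eq.
  by move=> ? _; apply: Fc.
- by apply: closed_bigI => i _; apply: closedI.
move=> e e0.
have [||| T [gam [T0 gamc gam0 gam1 gamC]]] :=
  @crossing_path R n A B e e0 A_closed B_closed.
- by move=> i x _; case: (leP 0 (F i x)) => [|/ltW]; [left; left|right; left].
- by move=> i x _ x0; right.
- by move=> i x _ x1; right.
have gamQ t : 0 <= t -> Q (gam t) by move=> /gamC[].
have hgam : {within `[0, T], continuous (h \o gam)}.
  apply: (within_continuous_comp_sub (B := Q)) => //.
    exact: continuous_subspaceT.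
  by move=> t; rewrite /= in_itv /= => /andP[t0 _]; apply: gamQ.
pose gamma := Curve T0 hgam.
have [||| sigma [[sa sb sE] sK sX sL sR]] := str gamma.
- move=> _ [t + <-]; rewrite /= in_itv /= => /andP[t0 _].
  by rewrite XE; exists (gam t) => //; apply: gamQ.
- exists (h (gam 0)); split; first by exists 0; rewrite //= in_itv /= lexx.
  by rewrite LE; exists (gam 0) => //; split => //; apply: gamQ.
- exists (h (gam T)); split; first by exists T; rewrite //= in_itv /= lexx andbT.
  by rewrite RE; exists (gam T) => //; split => //; apply: gamQ.
have sK' t : t \in `[curve_a sigma, curve_b sigma] -> K' (gam t).
  move=> tab; have /= st := sE t tab.
  split; first split.
  - by apply: gamQ; move: tab; rewrite in_itv /= => /andP[+ _]; apply: le_trans.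
  - by rewrite /= -st; apply: sK; exists t.
  - by rewrite /= -st; apply: sX; exists (sigma t) => //; exists t.
(* Where the image lies on the left side, the last coordinate of [phi] is 0; on the right side it is
   1. This fixes the signs of [F ord_max]. *)
have [t0 t0ab Ft0] : exists2 t, t \in `[curve_a sigma, curve_b sigma] &
    F ord_max (gam t) <= 0.
  have [_ [[_ [t tab <-] <-]]] := sL; rewrite LE => -[y [Qy y0] yE].
  exists t => //; have K't := sK' t tab; rewrite /F GE // /phi /= -[h _]sE //.
  rewrite -yE gK // y0 sub0r oppr_le0.
  by have /(_ ord_max)/andP[] := K'Q _ K't.
have [t1 t1ab Ft1] : exists2 t, t \in `[curve_a sigma, curve_b sigma] &
    0 <= F ord_max (gam t).
  have [_ [[_ [t tab <-] <-]]] := sR; rewrite RE => -[y [Qy y1] yE].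
  exists t => //; have K't := sK' t tab; rewrite /F GE // /phi /= -[h _]sE //.
  rewrite -yE gK // y1 subr_ge0.
  by have /(_ ord_max)/andP[] := K'Q _ K't.
have Fgam s t : {within `[s, t], continuous (F ord_max \o gam)}.
  apply: continuous_subspaceT => u.
  by apply: continuous_comp; [exact: gamc|exact: Fc].
have [t tab Ft] : exists2 t, t \in `[curve_a sigma, curve_b sigma] &
    F ord_max (gam t) = 0.
  move: t0ab t1ab; rewrite !in_itv /= => /andP[at0 t0b] /andP[at1 t1b].
  (* The image may cross [X] in either direction. *)
  have [t01|/ltW t10] := leP t0 t1.
    have [|t] := IVT t01 (Fgam _ _) (v := 0).
      by rewrite /= ge_min le_max Ft0 Ft1 orbT.
    rewrite in_itv /= => /andP[t0t tt1] Ft; exists t => //.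
    by rewrite in_itv /= (le_trans at0) // (le_trans tt1).
  have [|t] := IVT t10 (Fgam _ _) (v := 0).
    by rewrite /= ge_min le_max Ft0 Ft1 orbT.
  rewrite in_itv /= => /andP[t0t tt1] Ft; exists t => //.
  by rewrite in_itv /= (le_trans at1) // (le_trans tt1).
have t_ge0 : 0 <= t.
  by move: tab; rewrite in_itv /= => /andP[+ _]; apply: le_trans.
have [_ [c [_ cAB tc]]] := gamC t t_ge0.
by exists (gam t), c; split => //; split => //; apply: sK'.
Qed.
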